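(* Let $\Gamma=\operatorname{Bier}(\Delta)$ be a Bier sphere with $n\geq 3$ vertices. Then \[ \alpha(\Gamma)\leq\left\lfloor\frac n2\right\rfloor . \] This bound is sharp for every $n\geq 3$: for every $n\ge 3$ there is a Bier sphere with exactly $n$ vertices and independence number $\lfloor n/2\rfloor$. Consequently, for every $n\geq 3$, the maximum size of an independent set among Bier spheres on $n$ vertices is $\lfloor n/2\rfloor$.
   Context: Let $E=[m]=\{1,\dots,m\}$ and let $K\subsetneq 2^E$ be a nonempty family of subsets of $E$ closed under taking subsets, with $E\notin K$ (a simplicial complex on ground set $E$; not every singleton $\{i\}$ need belong to $K$). Its Alexander dual is $K^\vee=\{B\subseteq E: E\setminus B\notin K\}$. Let $\overline E=\{\bar 1,\dots,\bar m\}$ be a disjoint copy of $E$ and for $B\subseteq E$ put $\overline B=\{\bar i:i\in B\}$. The Bier complex (Bier sphere) $\operatorname{Bier}(K)$ is the simplicial complex whose faces are the sets $A\sqcup\overline B$ with $A\in K$, $B\in K^\vee$, $A\cap B=\varnothing$; it is a combinatorial sphere of dimension $m-2$. Its vertices are only the actual ones: $i$ is a vertex iff $\{i\}\in K$, and $\bar i$ is a vertex iff $\{i\}\in K^\vee$ (iff $E\setminus\{i\}\notin K$); absent labels are not counted. A Bier sphere is a complex of the form $\operatorname{Bier}(K)$ for some such $m$ and $K$. The independence number $\alpha(\Gamma)$ of a simplicial complex $\Gamma$ is the maximum size of a set of pairwise nonadjacent vertices in its $1$-skeleton. *)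

(* Defs.v *)
From mathcomp Require Import all_boot.
Set Implicit Arguments.
Unset Strict Implicit.
Unset Printing Implicit Defensive.

Section Complexes.
Variable T : finType.
Implicit Types (G : {set {set T}}) (u v : T) (S : {set T}).

Definition simplicial_complex G : Prop :=
  G != set0 /\ forall A B : {set T}, A \in G -> B \subset A -> B \in G.

(* An element v of T with [set v] \notin G is an unused label, not a vertex. *)
Definition vertices G : {set T} := [set v | [set v] \in G].

Definition adjacent G u v : bool := (u != v) && ([set u; v] \in G).

Definition independent G S : bool :=
  (S \subset vertices G) && [forall u in S, forall v in S, ~~ adjacent G u v].

Definition independence_number G : nat := \max_(S | independent G S) #|S|.

End Complexes.

(* The ground set {1, ..., m} is 'I_m = {0, ..., m - 1}. There is no admissible
   K when m = 0, since the only candidate for a face is then the full set. *)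
Definition bier_input (m : nat) (K : {set {set 'I_m}}) : Prop :=
  simplicial_complex K /\ [set: 'I_m] \notin K.

Definition alexander_dual (m : nat) (K : {set {set 'I_m}}) : {set {set 'I_m}} :=
  [set B : {set 'I_m} | ~: B \notin K].

(* The labels i and \bar i are inl i and inr i in the disjoint sum. *)
Definition bier (m : nat) (K : {set {set 'I_m}}) :
    {set {set ('I_m + 'I_m)%type}} :=
  [set inl @: A :|: inr @: B
     | A : {set 'I_m} in K, B : {set 'I_m} in alexander_dual K
     & [disjoint A & B]].

Definition is_maximum (P : nat -> Prop) (k : nat) : Prop :=
  P k /\ forall j : nat, P j -> j <= k.

Definition bier_independent_size (n k : nat) : Prop :=
  exists (m : nat) (K : {set {set 'I_m}}) (S : {set ('I_m + 'I_m)%type}),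
    [/\ bier_input K, #|vertices (bier K)| = n,
        independent (bier K) S & #|S| = k].

(* Main.v *)
Require Import Defs.
From mathcomp Require Import all_boot.

(** In the Bier sphere a vertex [i] and a vertex [\bar j] with [i] different
    from [j] always span an edge, whereas [i] and [\bar i] never do.  Hence an
    independent set is a pair [{i, \bar i}], or it lies in one of the two copies
    of the ground set, and then it is an independent set of [K], respectively
    of the Alexander dual of [K] ([independent_bier_cases]).  Alexander duality is
    an involution that exchanges the two copies, so for the upper bound only
    two cases remain: an independent set [A] of [K], and a pair [{i, \bar i}].

    Let [A] be independent in [K].  If it has at least three elements, then the
    complement of each [i] in [A] contains a pair that is not a face of [K], so
    it is not a face and [\bar i] is a vertex: the sphere has at least
    [2 * #|A|] vertices.  If it has two elements, or for a pair [{i, \bar i}],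
    the claim is that a sphere with a third vertex has a fourth one.  The reason
    is that [\bar l] is absent only if the complement of [l] is a face, which
    makes vertices of all other labels ([independent_card_half],
    [antipodal_pair_card]).

    For sharpness, let [K] consist of the empty set and [j] singletons over
    [m >= 3] labels ([points_complex]).  Then [j] labels are vertices of [K], all
    [m] labels are vertices of the dual, and the [j] points are pairwise
    nonadjacent.  For [n >= 5] take [j] and [m] to be [n / 2] rounded down and
    up.  For [n = 3] and [n = 4] this [m] would be too small; [m = 3] with
    [j = 0] and [j = 1] works, the independent sets being a single vertex and a
    pair [{i, \bar i}] ([bier_half_independent]). *)

Set Implicit Arguments.
Unset Strict Implicit.
Unset Printing Implicit Defensive.

(** * Alexander duality *)

Section Duality.
Variable m : nat.
Implicit Types (K : {set {set 'I_m}}) (A B : {set 'I_m}) (i j p : 'I_m).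

Lemma bier_input_sub K A B : bier_input K -> A \in K -> B \subset A -> B \in K.
Proof. by case=> -[_ subK] _; exact: subK. Qed.

Lemma bier_input_set0 K : bier_input K -> set0 \in K.
Proof.
move=> inK; have [[/set0Pn[A AK] _] _] := inK.
exact: bier_input_sub inK AK (sub0set A).
Qed.

Lemma alexander_dualK : involutive (@alexander_dual m).
Proof. by move=> K; apply/setP=> A; rewrite !inE setCK negbK. Qed.

Lemma bier_input_dual K : bier_input K -> bier_input (alexander_dual K).
Proof.
move=> inK; split; last by rewrite inE setCT negbK bier_input_set0.
split; first by apply/set0Pn; exists set0; rewrite inE setC0; case: inK.
move=> A B; rewrite !inE => AK sBA; apply: contra AK => BK.
by apply: bier_input_sub inK BK _; rewrite setCS.
Qed.

Lemma vertices_dual K i :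
  (i \in vertices (alexander_dual K)) = (~: [set i] \notin K).
Proof. by rewrite !inE. Qed.

Lemma face_sub_vertices K A : bier_input K -> A \in K -> A \subset vertices K.
Proof.
move=> inK AK; apply/subsetP=> i iA; rewrite inE.
by apply: bier_input_sub inK AK _; rewrite sub1set.
Qed.

End Duality.

(** * Vertices and independent sets of the Bier sphere *)

Lemma card_sum_set (T1 T2 : finType) (S : {set T1 + T2}) :
  #|S| = #|inl @^-1: S| + #|inr @^-1: S|.
Proof.
rewrite -!sum1_card big_sumType.
by congr (_ + _); apply: eq_bigl => i; rewrite inE.
Qed.

Section BierGraph.
Variables (m : nat) (K : {set {set 'I_m}}).
Hypothesis inK : bier_input K.
Implicit Types (i j : 'I_m) (X : {set 'I_m + 'I_m}).

Lemma mem_bier X :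
  (X \in bier K) = [&& inl @^-1: X \in K, inr @^-1: X \in alexander_dual K
                     & [disjoint inl @^-1: X & inr @^-1: X]].
Proof.
have inl_inj : injective (@inl 'I_m 'I_m) by move=> ? ? [].
have inr_inj : injective (@inr 'I_m 'I_m) by move=> ? ? [].
apply/imset2P/and3P => [[A B AK] | [AK BK dAB]].
  rewrite [B \in _]inE => /andP[BK dAB] ->.
  suff [-> ->] : inl @^-1: (inl @: A :|: inr @: B) = A
              /\ inr @^-1: (inl @: A :|: inr @: B) = B by [].
  split; apply/setP=> i; rewrite !inE mem_imset //.
    by case: imsetP => [[] //|]; rewrite orbF.
  by case: imsetP => [[] //|].
exists (inl @^-1: X) (inr @^-1: X); rewrite ?inE //=.
  by move: BK dAB; rewrite inE => -> ->.
apply/setP=> -[i|i]; rewrite !inE mem_imset // inE.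
  by case: imsetP => [[] //|]; rewrite orbF.
by case: imsetP => [[] //|].
Qed.

Lemma preimset1l i :
  (inl @^-1: [set inl i : 'I_m + 'I_m] = [set i])
  * (inr @^-1: [set inl i : 'I_m + 'I_m] = set0).
Proof. by split; apply/setP=> j; rewrite !inE. Qed.

Lemma preimset1r i :
  (inl @^-1: [set inr i : 'I_m + 'I_m] = set0)
  * (inr @^-1: [set inr i : 'I_m + 'I_m] = [set i]).
Proof. by split; apply/setP=> j; rewrite !inE. Qed.

Lemma mem_bier_inl X :
  inr @^-1: X = set0 -> (X \in bier K) = (inl @^-1: X \in K).
Proof.
move=> X0; rewrite mem_bier X0 (bier_input_set0 (bier_input_dual inK)).
by rewrite -setI_eq0 setI0 eqxx !andbT.
Qed.

Lemma mem_bier_inr X :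
  inl @^-1: X = set0 -> (X \in bier K) = (inr @^-1: X \in alexander_dual K).
Proof.
move=> X0; rewrite mem_bier X0 (bier_input_set0 inK).
by rewrite -setI_eq0 set0I eqxx !andbT.
Qed.

Lemma bier_vertex_inl i : (inl i \in vertices (bier K)) = (i \in vertices K).
Proof. by rewrite !inE mem_bier_inl preimset1l. Qed.

Lemma bier_vertex_inr i :
  (inr i \in vertices (bier K)) = (i \in vertices (alexander_dual K)).
Proof. by rewrite inE [RHS]inE mem_bier_inr preimset1r. Qed.

Lemma bier_adjacent_inl i j :
  adjacent (bier K) (inl i) (inl j) = adjacent K i j.
Proof. by rewrite /adjacent mem_bier_inl preimsetU !preimset1l ?setU0. Qed.

Lemma bier_adjacent_inr i j :
  adjacent (bier K) (inr i) (inr j) = adjacent (alexander_dual K) i j.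
Proof. by rewrite /adjacent mem_bier_inr preimsetU !preimset1r ?setU0. Qed.

Lemma bier_adjacent_mixed i j :
  i \in vertices K -> j \in vertices (alexander_dual K) ->
  adjacent (bier K) (inl i) (inr j) = (i != j).
Proof.
rewrite inE => iK; rewrite inE => jK.
rewrite /adjacent /= mem_bier !preimsetU !preimset1l !preimset1r setU0 set0U.
by rewrite iK jK disjoints1 inE.
Qed.

Lemma card_bier_vertices :
  #|vertices (bier K)| = #|vertices K| + #|vertices (alexander_dual K)|.
Proof.
rewrite card_sum_set; congr (_ + _); apply: eq_card => i; rewrite inE.
  exact: bier_vertex_inl.
exact: bier_vertex_inr.
Qed.

End BierGraph.

Lemma independentP (T : finType) (G : {set {set T}}) (S : {set T}) :
  reflect (S \subset vertices G /\ {in S &, forall u v, ~~ adjacent G u v})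
          (independent G S).
Proof.
apply: (iffP andP) => -[sS indS]; split=> //.
  by move=> u v uS vS; move/forall_inP/(_ u uS)/forall_inP/(_ v vS): indS.
by apply/forall_inP=> u uS; apply/forall_inP=> v vS; apply: indS.
Qed.

(** As soon as an independent set meets both copies of the ground set, any two
    of its vertices taken from different copies carry the same label, so a
    single label is involved. *)
Lemma independent_bier_cases m (K : {set {set 'I_m}}) (S : {set 'I_m + 'I_m}) :
  bier_input K -> independent (bier K) S ->
  [\/ exists2 A, independent K A & #|A| = #|S|,
      exists2 B, independent (alexander_dual K) B & #|B| = #|S|
    | exists2 i, i \in vertices K :&: vertices (alexander_dual K) & #|S| = 2].
Proof.
move=> inK /independentP[sS indS].
have indA : independent K (inl @^-1: S).
  apply/independentP; split=> [|i j].
    by apply/subsetP=> i; rewrite inE => /(subsetP sS); rewrite bier_vertex_inl.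
  by rewrite !inE => iS jS; rewrite -bier_adjacent_inl // indS.
have indB : independent (alexander_dual K) (inr @^-1: S).
  apply/independentP; split=> [|i j].
    by apply/subsetP=> i; rewrite inE => /(subsetP sS); rewrite bier_vertex_inr.
  by rewrite inE => iS; rewrite inE => jS; rewrite -bier_adjacent_inr // indS.
have cS := card_sum_set S.
have [A0|[i iA]] := set_0Vmem (inl @^-1: S).
  by constructor 2; exists (inr @^-1: S); rewrite // cS A0 cards0.
have [B0|[j jB]] := set_0Vmem (inr @^-1: S).
  by constructor 1; exists (inl @^-1: S); rewrite // cS B0 cards0 addn0.
have [/independentP[sA _] /independentP[sB _]] := (indA, indB).
have same p q : p \in inl @^-1: S -> q \in inr @^-1: S -> p = q.
  move=> pA qB; apply/eqP/negPn.
  rewrite -(@bier_adjacent_mixed _ K) ?(subsetP sA) ?(subsetP sB) //.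
  by apply: indS; move: pA qB; rewrite !inE.
have eij := same i j iA jB; rewrite -{j}eij in jB.
constructor 3; exists i; first by rewrite inE (subsetP sA) ?(subsetP sB).
have -> : S = [set inl i; inr i].
  apply/setP=> -[p|p]; rewrite !inE.
    rewrite orbF; apply/idP/eqP=> [pS|->]; last by move: iA; rewrite inE.
    by rewrite (same p i) // inE.
  rewrite /=; apply/idP/eqP=> [pS|->]; last by move: jB; rewrite inE.
  by rewrite (same i p) // inE.
by rewrite cards2.
Qed.

(** * The upper bound *)

Section UpperBound.
Variables (m : nat) (K : {set {set 'I_m}}).
Hypothesis inK : bier_input K.
Let V := vertices K.
Let W := vertices (alexander_dual K).
Implicit Types (A : {set 'I_m}) (i j l p : 'I_m).

Lemma missing_dual_vertex l p : l \notin W -> p != l -> p \in V.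
Proof.
rewrite vertices_dual negbK => lK pl.
by apply: (subsetP (face_sub_vertices inK lK)); rewrite !inE.
Qed.

Lemma nonface_dual_vertex A l : A \notin K -> l \notin A -> l \in W.
Proof.
move=> AK lA; rewrite vertices_dual; apply: contra AK => lK.
apply: bier_input_sub inK lK _; apply/subsetP=> i iA; rewrite !inE.
by apply: contraNneq lA => <-.
Qed.

(** Without a third label, the complement of [i], which is not a face, would lie
    in the face [[set l]]. *)
Lemma third_label i l : i \in W -> l \in V -> exists p, p \notin [set i; l].
Proof.
rewrite vertices_dual inE => iW lV.
have [s_il|/subsetPn[p _ pA]] := boolP (setT \subset [set i; l]); last first.
  by exists p.
case/negP: iW; apply: bier_input_sub inK lV _; apply/subsetP=> p.
by have := subsetP s_il p (in_setT p); rewrite !inE => /orP[->|].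
Qed.

Lemma card_ge3 A i j l : i \in A -> j \in A -> l \in A ->
  i != j -> l \notin [set i; j] -> 3 <= #|A|.
Proof.
move=> iA jA lA ij lij.
have <- : #|l |: [set i; j]| = 3 by rewrite cardsU1 lij cards2 ij.
by apply: subset_leq_card; rewrite !subUset !sub1set iA jA lA.
Qed.

(** Every label [p] other than [i] and [j] contributes [\bar p], because its
    complement contains the non-face [[set i; j]].  A fourth vertex is then
    [p] itself, unless both [\bar i] and [\bar j] are vertices. *)
Lemma nonedge_card i j : i \in V -> j \in V -> i != j -> [set i; j] \notin K ->
  3 <= #|V| + #|W| -> 4 <= #|V| + #|W|.
Proof.
move=> iV jV ij ijK n3.
have sV : [set i; j] \subset V by rewrite subUset !sub1set iV.
have V2 : 2 <= #|V| by have := subset_leq_card sV; rewrite cards2 ij.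
(* The third vertex has a third label, or is [\bar i] or [\bar j]. *)
have [p pij] : exists p, p \notin [set i; j].
  have [sVij|/subsetPn[p _ pij]] := boolP (V \subset [set i; j]); last first.
    by exists p.
  have [W0|[l lW]] := set_0Vmem W.
    have := subset_leq_card sVij; rewrite cards2 ij leqNgt.
    by rewrite -(addn0 #|V|) -(cards0 'I_m) -W0 n3.
  have [l_ij|] := boolP (l \in [set i; j]); last by exists l.
  move: l_ij lW; rewrite in_set2 => /orP[]/eqP-> lW.
    exact: third_label lW jV.
  by have [p] := third_label lW iV; exists p; rewrite setUC.
have pW : p \in W by exact: nonface_dual_vertex ijK pij.
have W1 : 1 <= #|W| by rewrite card_gt0; apply/set0Pn; exists p.
have [ijW|ijW] := boolP ([set i; j] \subset W).
  by apply: (leq_add V2); have := subset_leq_card ijW; rewrite cards2 ij.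
(* One of [\bar i] and [\bar j] is absent: [p] is a vertex besides [\bar p]. *)
have {ijW} [q qij qW] := subsetPn ijW.
have pV : p \in V.
  by apply: missing_dual_vertex qW _; apply: contraNneq pij => ->.
exact: (leq_add (card_ge3 iV jV pV ij pij) W1).
Qed.

(** For a second vertex [l] of [K], either [\bar l] is the fourth vertex of the
    sphere, or it is absent and all other labels are vertices of [K]. *)
Lemma antipodal_pair_card_of_two i : i \in V -> i \in W -> 2 <= #|V| ->
  4 <= #|V| + #|W|.
Proof.
move=> iV iW V2.
have /set0Pn[l] : V :\ i != set0.
  by rewrite -card_gt0; move: V2; rewrite (cardsD1 i V) iV.
rewrite in_setD1 => /andP[li lV]; have il : i != l by rewrite eq_sym.
have [lW|lW] := boolP (l \in W).
  apply: (leq_add V2); have <- : #|[set i; l]| = 2 by rewrite cards2 il.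
  by apply: subset_leq_card; rewrite subUset !sub1set iW.
have [p pil] := third_label iW lV.
have pV : p \in V.
  apply: missing_dual_vertex lW _; apply: contraNneq pil => ->.
  by rewrite !inE eqxx orbT.
apply: (leq_add (card_ge3 iV lV pV il pil)).
by rewrite card_gt0; apply/set0Pn; exists i.
Qed.

Lemma independent_card_half A : independent K A ->
  3 <= #|V| + #|W| -> #|A| <= (#|V| + #|W|) %/ 2.
Proof.
move=> /independentP[sAV indA] n3; rewrite leq_divRL // muln2.
have nonedge i j : i \in A -> j \in A -> i != j -> [set i; j] \notin K.
  by move=> iA jA ij; have := indA i j iA jA; rewrite /adjacent ij.
case: (ltngtP #|A| 2) => [|A3|A2].
- by case: #|A| => [|[]] // _; apply: leq_trans n3.
- have sAW : A \subset W.
    apply/subsetP=> i iA.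
    have : 1 < #|A :\ i| by move: A3; rewrite (cardsD1 i A) iA.
    case/card_gt1P=> j [l []]; rewrite !in_setD1 => /andP[ji jA] /andP[li lA] jl.
    apply: nonface_dual_vertex (nonedge j l jA lA jl) _.
    by rewrite !inE negb_or !(eq_sym i) ji.
  by rewrite -addnn; apply: leq_add; apply: subset_leq_card.
move/eqP/cards2P: (A2) => [i [j [ij eA]]].
have [iA jA] : i \in A /\ j \in A by rewrite eA !inE !eqxx orbT.
rewrite A2; apply: nonedge_card (nonedge i j iA jA ij) n3 => //.
  exact: (subsetP sAV).
exact: (subsetP sAV).
Qed.

End UpperBound.

(** With three vertices, [K] or its dual has two of them, and the roles of [K]
    and its dual can be exchanged. *)
Lemma antipodal_pair_card m (K : {set {set 'I_m}}) i : bier_input K ->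
  i \in vertices K :&: vertices (alexander_dual K) ->
  3 <= #|vertices K| + #|vertices (alexander_dual K)| ->
  4 <= #|vertices K| + #|vertices (alexander_dual K)|.
Proof.
move=> inK; rewrite in_setI => /andP[iV iW] n3.
have [V2|V1] := leqP 2 #|vertices K|.
  exact: antipodal_pair_card_of_two iV iW V2.
rewrite addnC -{2}(alexander_dualK K).
apply: (@antipodal_pair_card_of_two _ _ (bier_input_dual inK) i) => //.
  by rewrite alexander_dualK.
rewrite -(leq_add2l 1); apply: leq_trans n3 _.
by rewrite leq_add2r -ltnS.
Qed.

Lemma bier_independence_bound m (K : {set {set 'I_m}}) :
  bier_input K -> 3 <= #|vertices (bier K)| ->
  independence_number (bier K) <= #|vertices (bier K)| %/ 2.
Proof.
move=> inK; rewrite (card_bier_vertices inK) => n3.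
apply/bigmax_leqP=> S indS.
have [[A indA <-]|[B indB <-]|[i iVW ->]] := independent_bier_cases inK indS.
- exact: independent_card_half.
- rewrite addnC in n3 *; rewrite -{2}(alexander_dualK K).
  apply: independent_card_half; rewrite ?alexander_dualK //.
  exact: bier_input_dual.
by rewrite leq_divRL //; exact: antipodal_pair_card iVW n3.
Qed.

(** * Sharpness *)

Section Points.
Variable m : nat.
Implicit Types P A : {set 'I_m}.

Definition points_complex P : {set {set 'I_m}} :=
  [set A : {set 'I_m} | (A \subset P) && (#|A| <= 1)].

Lemma points_complex_input P : 1 < m -> bier_input (points_complex P).
Proof.
move=> m2; split; last by rewrite inE cardsT card_ord leqNgt m2 andbF.
split; first by apply/set0Pn; exists set0; rewrite inE sub0set cards0.
move=> A B; rewrite !inE => /andP[sAP A1] sBA.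
by rewrite (subset_trans sBA) ?(leq_trans (subset_leq_card sBA)).
Qed.

Lemma vertices_points_complex P : vertices (points_complex P) = P.
Proof. by apply/setP=> i; rewrite !inE sub1set cards1 andbT. Qed.

(** The complement of a label has at least two elements, so it is not a face.
    For [m = 2] it would be a point, possibly one of [P]. *)
Lemma vertices_dual_points_complex P :
  2 < m -> vertices (alexander_dual (points_complex P)) = setT.
Proof.
move=> m3; apply/setP=> i; rewrite vertices_dual !inE negb_and -ltnNge.
by rewrite cardsC1 card_ord -subn1 ltn_subRL m3 orbT.
Qed.

Lemma card_bier_points_complex P : 2 < m ->
  #|vertices (bier (points_complex P))| = #|P| + m.
Proof.
move=> m3; rewrite card_bier_vertices; last exact/points_complex_input/ltnW.
rewrite vertices_points_complex vertices_dual_points_complex //.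
by rewrite cardsT card_ord.
Qed.

Lemma points_independent P : 1 < m ->
  independent (bier (points_complex P)) (inl @: P).
Proof.
move=> m2; have inK := points_complex_input P m2.
apply/independentP; split.
  apply/subsetP=> _ /imsetP[i iP ->].
  by rewrite bier_vertex_inl // vertices_points_complex.
move=> _ _ /imsetP[i iP ->] /imsetP[j jP ->].
rewrite bier_adjacent_inl // /adjacent inE cards2.
by case: (i != j); rewrite ?andbF.
Qed.

Lemma antipodal_pair_independent P i : 2 < m -> i \in P ->
  independent (bier (points_complex P)) [set inl i; inr i].
Proof.
move=> m3 iP; have inK := points_complex_input P (ltnW m3).
have iV : i \in vertices (points_complex P) by rewrite vertices_points_complex.
have iW : i \in vertices (alexander_dual (points_complex P)).
  by rewrite vertices_dual_points_complex ?inE.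
have mixed := bier_adjacent_mixed iV iW; rewrite eqxx in mixed.
apply/independentP; split.
  by rewrite subUset !sub1set bier_vertex_inl // bier_vertex_inr // iV.
move=> u v; rewrite !inE => /orP[]/eqP-> /orP[]/eqP->; rewrite ?mixed //.
1,3: by rewrite /adjacent eqxx.
by move: mixed; rewrite /adjacent eq_sym setUC => ->.
Qed.

End Points.

(** For [n >= 5] the points of [P] themselves form the independent set.  In the
    two small cases [P] is too small for that: [n = 3] gives the boundary of a
    triangle, and for [n = 4] the pair of [ord0] and its copy is used. *)
Lemma bier_half_independent n : 3 <= n ->
  exists (m : nat) (K : {set {set 'I_m}}) (S : {set 'I_m + 'I_m}),
    [/\ bier_input K, #|vertices (bier K)| = n,
        independent (bier K) S & #|S| = n %/ 2].
Proof.
have inl_inj k : injective (@inl 'I_k 'I_k) by move=> ? ? [].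
have [n5 _|] := leqP 5 n.
  have m3 : 2 < uphalf n by rewrite -[3]/(uphalf 5) uphalf_leq.
  have [P cP] : exists P : {set 'I_(uphalf n)}, #|P| = n./2.
    have : n./2 <= #|[set: 'I_(uphalf n)]|.
      by rewrite cardsT card_ord uphalf_half leq_addl.
    case/card_geqP=> s [us <- _]; exists [set x in s].
    by rewrite cardsE; apply/card_uniqP.
  exists (uphalf n), (points_complex P), (inl @: P); split.
  - exact: points_complex_input (ltnW m3).
  - rewrite card_bier_points_complex // cP uphalf_half addnCA addnn.
    exact: odd_double_half.
  - exact: points_independent (ltnW m3).
  - by rewrite (card_imset _ (@inl_inj _)) cP divn2.
case: n => [|[|[|[|[|n]]]]] // _ _.
  exists 3, (points_complex set0), [set inr ord0]; split.
  - exact: points_complex_input.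
  - by rewrite card_bier_points_complex // cards0.
  - have inK := points_complex_input set0 (isT : 1 < 3).
    apply/independentP; split.
      by rewrite sub1set bier_vertex_inr // vertices_dual_points_complex ?inE.
    by move=> u v /set1P-> /set1P->; rewrite /adjacent eqxx.
  - by rewrite cards1.
exists 3, (points_complex [set ord0]), [set inl ord0; inr ord0]; split.
- exact: points_complex_input.
- by rewrite card_bier_points_complex // cards1.
- exact: antipodal_pair_independent (set11 _).
- by rewrite cards2.
Qed.

Theorem theorem1p4 :
  (forall (m : nat) (K : {set {set 'I_m}}) (n : nat),
     bier_input K -> #|vertices (bier K)| = n -> 3 <= n ->
     independence_number (bier K) <= n %/ 2)
  /\ (forall n : nat, 3 <= n ->
        exists (m : nat) (K : {set {set 'I_m}}),
          [/\ bier_input K, #|vertices (bier K)| = n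
            & independence_number (bier K) = n %/ 2])
  /\ (forall n : nat, 3 <= n ->
        is_maximum (bier_independent_size n) (n %/ 2)).
Proof.
have bound m (K : {set {set 'I_m}}) n : bier_input K ->
    #|vertices (bier K)| = n -> 3 <= n -> independence_number (bier K) <= n %/ 2.
  by move=> inK <-; exact: bier_independence_bound.
have size_le m (K : {set {set 'I_m}}) S :
    independent (bier K) S -> #|S| <= independence_number (bier K).
  by move=> indS; exact: (leq_bigmax_cond S indS).
split=> //; split=> n n3; last first.
  split; first exact: bier_half_independent.
  move=> _ [m [K [S [inK cV indS <-]]]].
  exact: leq_trans (size_le _ _ _ indS) (bound _ _ _ inK cV n3).
have [m [K [S [inK cV indS cS]]]] := bier_half_independent n3.
exists m, K; split=> //; apply/eqP; rewrite eqn_leq bound //=.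
by rewrite -cS size_le.
Qed.
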